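(* Let $(K_{1,o},\dots,K_{N,o})$ be the given Nash equilibrium feedback laws of the observed game with dynamics matrices $A$ and $\mathbf B=(B_1,\dots,B_N)$. Let symmetric matrices $R_{ii}>0$, $R_{ij}\ge 0$ ($j\ne i$), $Q_i^{(0)}\ge 0$ be given for $i,j\in\{1,\dots,N\}$, let the step sizes $\alpha_i$ be such that the model-based iteration (defined in the context) converges, and let $Q_i^\infty=\lim_{s\to\infty}Q_i^{(s)}$ be the limits it generates. Then the game $(A,\mathbf B,\mathbf Q^\infty,\mathbf R)$ with $\mathbf Q^\infty=(Q_1^\infty,\dots,Q_N^\infty)$ and $\mathbf R=(R_{ij})_{i,j=1}^N$ has $(K_{1,o},\dots,K_{N,o})$ as a Nash equilibrium.
   Context: Notation: for symmetric matrices, $M>0$ and $M\ge 0$ mean positive definite and positive semidefinite. The players are $i\in\mathcal N=\{1,\dots,N\}$. A superscript $(s)$ denotes the value at iteration $s$. Write $A_i=A-\sum_{j\ne i}B_jK_{j,o}$. Game. $(A,\mathbf B,\mathbf Q,\mathbf R)$ denotes the game with dynamics $x(k+1)=Ax(k)+\sum_{j=1}^N B_ju_j(k)$, where $x(k)\in\mathbb R^n$, $u_j(k)\in\mathbb R^{m_j}$, $A\in\mathbb R^{n\times n}$, $B_j\in\mathbb R^{n\times m_j}$ (the system is assumed stabilizable), and in which player $i$ minimizes $J_i=\sum_{t=k}^\infty\big(x^\top(t)Q_ix(t)+\sum_{j=1}^N u_j^\top(t)R_{ij}u_j(t)\big)$ with symmetric $Q_i,R_{ij}$ and $R_{ii}>0$.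 Players use feedback laws $u_i(k)=-K_ix(k)$, and admissible profiles are $$\mathcal K=\{(K_1,\dots,K_N): \text{all eigenvalues of } A-\textstyle\sum_{j=1}^N B_jK_j \text{ lie in } \{\lambda\in\mathbb C:|\lambda|<1\}\}.$$ A profile $(K_1^*,\dots,K_N^* )\in\mathcal K$ is a Nash equilibrium (NE) if for each $i$, each initial state and each $K_i$ with $(K_i,K_{-i}^* )\in\mathcal K$, the cost $J_i$ under $(K_i^*,K_{-i}^* )$ is at most the cost $J_i$ under $(K_i,K_{-i}^* )$, where $K_{-i}^*$ denotes the laws of the other players. Observed game. $(K_{1,o},\dots,K_{N,o})$ is a NE of a game with the dynamics above and unknown symmetric cost parameters $Q_{i,o}\ge 0$, $R_{ij,o}\ge 0$, $R_{ii,o}>0$. In particular $A-\sum_jB_jK_{j,o}$ has all eigenvalues in the open unit disc. Model-based iteration (Algorithm 1). For $s=0,1,2,\dots$ and each $i$, with step sizes $\alpha_i\in(0,1]$ and the $R_{ij}$ kept fixed: $P_i^{(s+1)}$ is the solution of the Stein equation $$Q_i^{(s)}+\sum_{j=1}^N K_{j,o}^\top R_{ij}K_{j,o}-P_i^{(s+1)}+(A_i-B_iK_{i,o})^\top P_i^{(s+1)}(A_i-B_iK_{i,o})=0,$$ and then $$Q_i^{(s+1)}=Q_i^{(s)}+\alpha_i\,\delta_i^{(s+1)\top}(R_{ii}+B_i^\top P_i^{(s+1)}B_i)\,\delta_i^{(s+1)},\quad \delta_i^{(s+1)}=(R_{ii}+B_i^\top P_i^{(s+1)}B_i)^{-1}B_i^\top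 P_i^{(s+1)}A_i-K_{i,o}.$$ *)

(* Defs.v *)
From HB Require Import structures.
From mathcomp Require Import all_boot all_order all_algebra.
From mathcomp Require Import complex.
From mathcomp Require Import all_classical all_reals all_analysis.

Set Implicit Arguments.
Unset Strict Implicit.
Unset Printing Implicit Defensive.

Import Order.TTheory GRing.Theory Num.Theory.
Import numFieldNormedType.Exports.

Local Open Scope ring_scope.
Local Open Scope classical_set_scope.

Section Matrices.
Variable R : realType.

Definition quadform n (M : 'M[R]_n) (x : 'cV[R]_n) : R :=
  (x^T *m M *m x) ord0 ord0.

Definition psdmx n (M : 'M[R]_n) : Prop :=
  M \is symmetricmx /\ forall x : 'cV[R]_n, 0 <= quadform M x.

Definition pdmx n (M : 'M[R]_n) : Prop :=
  M \is symmetricmx /\ forall x : 'cV[R]_n, x != 0 -> 0 < quadform M x.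

(* The eigenvalues are the complex ones.  The order on [R[i]] is partial, but
   [`|z|] is always real there, so [`|z| < 1] is the usual inequality. *)
Definition schur_stable n (M : 'M[R]_n) : Prop :=
  forall z : R[i],
    eigenvalue (map_mx (real_complex R) M : 'M[R[i]]_n) z -> `|z| < 1.

End Matrices.

Section Games.
Variables (R : realType) (N n : nat) (m : 'I_N -> nat).

Definition input_matrices := forall j : 'I_N, 'M[R]_(n, m j).
Definition profile := forall j : 'I_N, 'M[R]_(m j, n).

Record lqgame := LQGame {
  dynA : 'M[R]_n;
  dynB : input_matrices;
  costQ : 'I_N -> 'M[R]_n;
  costR : 'I_N -> forall j : 'I_N, 'M[R]_(m j)
}.

Definition closed_loop (A : 'M[R]_n) (B : input_matrices) (K : profile)
    : 'M[R]_n :=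
  A - \sum_j B j *m K j.

Definition admissible (A : 'M[R]_n) (B : input_matrices) (K : profile) : Prop :=
  schur_stable (closed_loop A B K).

Definition stabilizable (A : 'M[R]_n) (B : input_matrices) : Prop :=
  exists K : profile, admissible A B K.

Definition is_lqgame (G : lqgame) : Prop :=
  [/\ stabilizable (dynA G) (dynB G),
      forall i, costQ G i \is symmetricmx,
      forall i j, costR G i j \is symmetricmx
    & forall i, pdmx (costR G i i)].

Definition input (K : profile) (j : 'I_N) (x : 'cV[R]_n) : 'cV[R]_(m j) :=
  - (K j *m x).

Fixpoint state (A : 'M[R]_n) (B : input_matrices) (K : profile)
    (x0 : 'cV[R]_n) (t : nat) : 'cV[R]_n :=
  if t is t'.+1 then
    let x := state A B K x0 t' in A *m x + \sum_j B j *m input K j x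
  else x0.

Definition stage_cost (G : lqgame) (i : 'I_N) (K : profile) (x : 'cV[R]_n) : R :=
  quadform (costQ G i) x + \sum_j quadform (costR G i j) (input K j x).

(* Dynamics and laws are time-invariant, so the initial time is taken to be 0.
   [limn] is only meaningful for a convergent series; for an admissible profile
   the state decays geometrically and the series converges absolutely. *)
Definition cost (G : lqgame) (i : 'I_N) (K : profile) (x0 : 'cV[R]_n) : R :=
  limn (series (fun t =>
    stage_cost G i K (state (dynA G) (dynB G) K x0 t))).

Definition is_nash (G : lqgame) (K : profile) : Prop :=
  admissible (dynA G) (dynB G) K /\
  forall (i : 'I_N) (x0 : 'cV[R]_n) (Ki : 'M[R]_(m i, n)),
    admissible (dynA G) (dynB G) (dfwith K i Ki) ->
    cost G i K x0 <= cost G i (dfwith K i Ki) x0.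

Definition others_loop (A : 'M[R]_n) (B : input_matrices) (K : profile)
    (i : 'I_N) : 'M[R]_n :=
  A - \sum_(j | j != i) B j *m K j.

Definition stein_eq (A : 'M[R]_n) (B : input_matrices) (Ko : profile)
    (Rc : 'I_N -> forall j : 'I_N, 'M[R]_(m j)) (i : 'I_N)
    (Q P : 'M[R]_n) : Prop :=
  let F := others_loop A B Ko i - B i *m Ko i in
  Q + (\sum_j (Ko j)^T *m Rc i j *m Ko j) - P + F^T *m P *m F = 0.

Definition gain_weight (B : input_matrices)
    (Rc : 'I_N -> forall j : 'I_N, 'M[R]_(m j)) (i : 'I_N) (P : 'M[R]_n)
    : 'M[R]_(m i) :=
  Rc i i + (B i)^T *m P *m B i.

Definition gain_gap (A : 'M[R]_n) (B : input_matrices) (Ko : profile)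
    (Rc : 'I_N -> forall j : 'I_N, 'M[R]_(m j)) (i : 'I_N) (P : 'M[R]_n)
    : 'M[R]_(m i, n) :=
  invmx (gain_weight B Rc i P) *m (B i)^T *m P *m others_loop A B Ko i - Ko i.

(* The Stein equation at step [s] produces [P s.+1], so [P 0] is unconstrained
   and never used. *)
Definition model_based_iteration (A : 'M[R]_n) (B : input_matrices)
    (Ko : profile) (Rc : 'I_N -> forall j : 'I_N, 'M[R]_(m j))
    (alpha : 'I_N -> R) (Q0 : 'I_N -> 'M[R]_n)
    (P Q : nat -> 'I_N -> 'M[R]_n) : Prop :=
  [/\ forall i, Q 0%N i = Q0 i,
      forall s i, stein_eq A B Ko Rc i (Q s i) (P s.+1 i)
    & forall s i,
        let delta := gain_gap A B Ko Rc i (P s.+1 i) in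
        Q s.+1 i = Q s i +
          alpha i *: (delta^T *m gain_weight B Rc i (P s.+1 i) *m delta)].

End Games.

(* Main.v *)
(* The limit Qinf generates a Stein solution Pinf, the limit of the P_i^(s),
   because a Schur stable closed loop makes the Stein operator invertible.
   Convergence of Q_i^(s) forces delta^T W delta -> 0 for the gain gap delta with
   weight W, so B_i^T Pinf A_i = W K_{i,o} in the limit.  The cost of an admissible
   profile is x^T P x with P its Stein solution; completing the square, the
   difference between the Stein solution of a deviation K_i and Pinf solves a
   Stein equation with right-hand side (K_i - K_{i,o})^T W (K_i - K_{i,o}) >= 0,
   hence is itself nonnegative. *)
Require Import Defs.
From mathcomp Require Import all_boot all_order all_algebra.
From mathcomp Require Import complex ring lra.
From mathcomp Require Import all_classical all_reals all_analysis.

Set Implicit Arguments.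
Unset Strict Implicit.
Unset Printing Implicit Defensive.

Import Order.TTheory GRing.Theory Num.Theory.
Import numFieldNormedType.Exports.

Local Open Scope ring_scope.
Local Open Scope classical_set_scope.

(** * Scalar sequences under a perturbed contraction *)

Section Recurrences.
Variable R : realType.

Lemma cvg0_contraction_recurrence (b e : R ^nat) (r : R) :
  0 <= r < 1 -> (forall t, 0 <= b t) ->
  (forall t, b t.+1 <= r * b t + e t) ->
  e t @[t --> \oo] --> 0 -> b t @[t --> \oo] --> 0.
Proof.
move=> /andP[r0 r1] b0 be e0; apply/cvgr0Pnorm_lt => eps eps0.
have q0 : 0 < 1 - r by rewrite subr_gt0.
(* With this threshold [eps / 2] is a fixed point of the worst-case recurrence: [r * (eps / 2) + eps
   * (1 - r) / 2 = eps / 2]. The errors after time [T] thus never accumulate beyond [eps / 2]. *)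
have /cvgr0Pnorm_lt /(_ (eps * (1 - r) / 2)) := e0.
case=> [|T _ eT]; first by rewrite divr_gt0 ?mulr_gt0.
have bT k : b (k + T)%N <= r ^+ k * b T + eps / 2.
  elim: k => [|k IHk]; first by rewrite expr0 mul1r lerDl divr_ge0 ?ltW.
  have := be (k + T)%N; rewrite -addSn exprS => le_b.
  have /= := eT (k + T)%N (leq_addl _ _).
  move/(le_lt_trans (ler_norm _)) => lt_e.
  have := ler_wpM2l r0 IHk; nra.
have : r ^+ k * b T @[k --> \oo] --> 0.
  rewrite -(mul0r (b T)); apply: cvgM; last exact: cvg_cst.
  by apply: cvg_expr; rewrite ger0_norm.
move/cvgr0Pnorm_lt => /(_ (eps / 2)).
case=> [|k0 _ lt_k]; first by rewrite divr_gt0.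
exists (k0 + T)%N => // t /= le_t.
have -> : t = (t - T + T)%N by rewrite subnK // (leq_trans _ le_t) // leq_addl.
rewrite ger0_norm //; apply: le_lt_trans (bT _) _.
have le_k : (k0 <= t - T)%N.
  by rewrite leq_subRL ?(leq_trans _ le_t) ?leq_addl // addnC.
have /(le_lt_trans (ler_norm _)) := lt_k _ le_k.
by rewrite -(ltrD2r (eps / 2)) -splitr.
Qed.

End Recurrences.

(** * Powers of a Schur stable matrix *)

Section SchurStablePowers.
Variable R : realType.

Local Notation normc := (@ComplexField.Normc.normc R).

Lemma normc_ge0 (z : R[i]) : 0 <= normc z.
Proof. by rewrite -lecR; exact: (normr_ge0 z). Qed.

(* The modal argument behind spectral radius < 1: peeling off one root z of an
   annihilating polynomial, F^(t+1) v = z F^t v + F^t w with w = (F - z) v killed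
   by the remaining roots. *)
Lemma iter_mulmx_cvg0_roots n (F : 'M[R[i]]_n.+1) (r : seq R[i])
    (v : 'cV[R[i]]_n.+1) :
  (forall z, z \in r -> `|z| < 1) ->
  horner_mx F (\prod_(z <- r) ('X - z%:P)) *m v = 0 ->
  forall i, normc (iter t (mulmx F) v i ord0) @[t --> \oo] --> (0 : R).
Proof.
elim: r v => [|z r IHr] v lt_r.
  rewrite big_nil rmorph1 mul1mx => -> i.
  rewrite [X in X @ _ --> _](_ : _ = fun=> 0); first exact: cvg_cst.
  apply/funext => t; have -> : iter t (mulmx F) 0 = 0 :> 'cV_n.+1.
    by elim: t => //= t ->; rewrite mulmx0.
  by rewrite mxE ComplexField.Normc.normc0.
rewrite big_cons mulrC rmorphM /= -mulmxA => v0 i.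
pose w := horner_mx F ('X - z%:P) *m v.
have wE : w = F *m v - z *: v.
  by rewrite /w rmorphB /= horner_mx_X horner_mx_C mulmxBl mul_scalar_mx.
have iterE t :
    iter t.+1 (mulmx F) v = z *: iter t (mulmx F) v + iter t (mulmx F) w.
  elim: t => [|t IHt]; first by rewrite /= wE addrC subrK.
  by rewrite [LHS]iterS [in LHS]IHt mulmxDr -scalemxAr -!iterS.
have w0 := IHr w (fun y yr => lt_r y (@mem_behead _ (z :: r) y yr)) v0 i.
apply: (@cvg0_contraction_recurrence _ _ _ (normc z) _ _ _ w0).
- by rewrite normc_ge0 -ltcR; exact: (lt_r z (mem_head _ _)).
- by move=> t; exact: normc_ge0.
move=> t; rewrite iterE !mxE -ComplexField.Normc.normcM; exact: le_normcD.
Qed.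

(** Over the complex numbers the characteristic polynomial splits, its roots are eigenvalues and so
    have modulus below 1, and by Cayley-Hamilton it annihilates every vector. The real orbit embeds
    in the complex one. *)
Lemma schur_stable_iter_cvg0 n (F : 'M[R]_n) (x : 'cV[R]_n) :
  schur_stable F -> forall i, iter t (mulmx F) x i ord0 @[t --> \oo] --> 0.
Proof.
case: n F x => [F x _ []//|n F x stabF i].
pose FC : 'M[R[i]]_n.+1 := map_mx (real_complex R) F.
have [r charE] := closed_field_poly_normal (char_poly FC).
have lt_r z : z \in r -> `|z| < 1.
  move=> zr; apply: stabF; rewrite eigenvalue_root_char charE rootZ.
    by rewrite root_prod_XsubC.
  by rewrite (monicP (char_poly_monic _)) oner_neq0.
have := @iter_mulmx_cvg0_roots _ FC r (map_mx (real_complex R) x) lt_r.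
move: charE; rewrite (monicP (char_poly_monic _)) scale1r => <-.
rewrite Cayley_Hamilton mul0mx => /(_ erefl i) /cvgr0Pnorm_lt cvgC.
apply/cvgr0Pnorm_lt => e /cvgC; apply: filterS => t /=.
have -> : iter t (mulmx FC) (map_mx (real_complex R) x) =
    map_mx (real_complex R) (iter t (mulmx F) x).
  by elim: t => //= t ->; rewrite map_mxM.
rewrite mxE ger0_norm ?normc_ge0 // /ComplexField.Normc.normc /=.
by rewrite expr0n addr0 sqrtr_sqr.
Qed.

End SchurStablePowers.

(** * Entrywise limits of matrix sequences *)

Section MatrixLimits.
Variable R : realType.

Lemma cvg_mx p q (u : nat -> 'M[R]_(p, q)) (M : 'M[R]_(p, q)) :
  (forall i j, u s i j @[s --> \oo] --> M i j) -> u s @[s --> \oo] --> M.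
Proof.
move=> u_cvg A [P Pnbhs subA].
have : \forall s \near \oo, forall i, forall j, P i j (u s i j).
  by apply: filter_forall => i; apply: filter_forall => j; exact: u_cvg.
by apply: filterS => s Ps; exact: subA.
Qed.

Lemma cvg_mx_entry p q (u : nat -> 'M[R]_(p, q)) (M : 'M[R]_(p, q)) i j :
  u s @[s --> \oo] --> M -> u s i j @[s --> \oo] --> M i j.
Proof.
move=> u_cvg.
exact: (@continuous_cvg _ _ _ _ _ u (fun N : 'M[R]_(p, q) => N i j) M
          (@coord_continuous _ _ _ i j M)).
Qed.

Lemma cvg_mulmx p q r (u : nat -> 'M[R]_(p, q)) (v : nat -> 'M[R]_(q, r))
    (M : 'M[R]_(p, q)) (N : 'M[R]_(q, r)) :
  u s @[s --> \oo] --> M -> v s @[s --> \oo] --> N ->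
  u s *m v s @[s --> \oo] --> M *m N.
Proof.
move=> u_cvg v_cvg; apply: cvg_mx => i j; rewrite mxE.
rewrite [X in X @ _ --> _](_ : _ = fun s => \sum_k u s i k * v s k j).
  apply: (@cvg_big _ _ _ _ _ (@add_continuous _)) => k _.
  by apply: cvgM; exact: cvg_mx_entry.
by apply/funext => s; rewrite mxE.
Qed.

Lemma cvg_trmx p q (u : nat -> 'M[R]_(p, q)) (M : 'M[R]_(p, q)) :
  u s @[s --> \oo] --> M -> (u s)^T @[s --> \oo] --> M^T.
Proof.
move=> u_cvg; apply: cvg_mx => i j; rewrite mxE.
under eq_cvg do rewrite mxE.
exact: cvg_mx_entry.
Qed.

Lemma cvg_mxvec p q (u : nat -> 'M[R]_(p, q)) (M : 'M[R]_(p, q)) :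
  u s @[s --> \oo] --> M -> mxvec (u s) @[s --> \oo] --> mxvec M.
Proof.
move=> u_cvg; apply: cvg_mx => i j; rewrite (ord1 i).
case/mxvec_indexP: j => k l; rewrite mxvecE.
under eq_cvg do rewrite mxvecE.
exact: cvg_mx_entry.
Qed.

Lemma cvg_vec_mx p q (u : nat -> 'rV[R]_(p * q)) (M : 'rV[R]_(p * q)) :
  u s @[s --> \oo] --> M -> vec_mx (u s) @[s --> \oo] --> vec_mx M.
Proof.
move=> u_cvg; apply: cvg_mx => i j; rewrite mxE.
under eq_cvg do rewrite mxE.
exact: cvg_mx_entry.
Qed.

Lemma cvg_quadform p (u : nat -> 'M[R]_p) (x : nat -> 'cV[R]_p)
    (M : 'M[R]_p) (y : 'cV[R]_p) :
  u s @[s --> \oo] --> M -> x s @[s --> \oo] --> y ->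
  quadform (u s) (x s) @[s --> \oo] --> quadform M y.
Proof.
move=> u_cvg x_cvg; apply: cvg_mx_entry.
by apply: (cvg_mulmx _ x_cvg); apply: (cvg_mulmx _ u_cvg); exact: cvg_trmx.
Qed.

End MatrixLimits.

(** * Quadratic forms and semidefinite matrices *)

Section QuadraticForms.
Variable R : realType.

Lemma symmxP p (M : 'M[R]_p) : reflect (M^T = M) (M \is symmetricmx).
Proof.
rewrite is_hermitianmxE expr0 scale1r map_mx_id // eq_sym; exact: eqP.
Qed.

Lemma quadformD p (M N : 'M[R]_p) x :
  quadform (M + N) x = quadform M x + quadform N x.
Proof. by rewrite /quadform mulmxDr mulmxDl mxE. Qed.

Lemma quadformN p (M : 'M[R]_p) x : quadform (- M) x = - quadform M x.
Proof. by rewrite /quadform mulmxN mulNmx mxE. Qed.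

Lemma quadformZ p a (M : 'M[R]_p) x : quadform (a *: M) x = a * quadform M x.
Proof. by rewrite /quadform -scalemxAr -scalemxAl mxE. Qed.

Lemma quadform_sum p (I : finType) (M : I -> 'M[R]_p) x :
  quadform (\sum_i M i) x = \sum_i quadform (M i) x.
Proof. by rewrite /quadform mulmx_sumr mulmx_suml summxE. Qed.

Lemma quadform_v0 p (M : 'M[R]_p) : quadform M 0 = 0.
Proof. by rewrite /quadform mulmx0 mxE. Qed.

Lemma quadform_congr p q (M : 'M[R]_p) (K : 'M[R]_(p, q)) x :
  quadform (K^T *m M *m K) x = quadform M (K *m x).
Proof. by rewrite /quadform trmx_mul !mulmxA. Qed.

Lemma quadform_oppv p (M : 'M[R]_p) x : quadform M (- x) = quadform M x.
Proof.
have -> : - x = (- 1)%:M *m x by rewrite mul_scalar_mx scaleN1r.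
by rewrite -quadform_congr tr_scalar_mx mul_scalar_mx mul_mx_scalar
  !scaleN1r opprK.
Qed.

Lemma quadform_addv p (M : 'M[R]_p) (x y : 'cV[R]_p) : M^T = M ->
  quadform M (x + y) =
    quadform M x + 2 * (x^T *m M *m y) ord0 ord0 + quadform M y.
Proof.
move=> symM; rewrite /quadform [(x + y)^T]linearD /= !mulmxDl !mulmxDr.
have -> : y^T *m M *m x = x^T *m M *m y.
  have tr1 (a : 'M[R]_1) : a = a^T by apply/matrixP => i j; rewrite mxE !ord1.
  by rewrite [LHS]tr1 !trmx_mul trmxK symM mulmxA.
have addE (a b : 'M[R]_1) : (a + b) ord0 ord0 = a ord0 ord0 + b ord0 ord0.
  by rewrite mxE.
by rewrite !addE mulr2n mulrDl mul1r !addrA.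
Qed.

Lemma pdmx_ge0 p (M : 'M[R]_p) x : pdmx M -> 0 <= quadform M x.
Proof.
case=> _ posM; have [->|/posM/ltW//] := eqVneq x 0.
by rewrite quadform_v0.
Qed.

(** A nonzero row [v] with [v *m M = 0] would give the form the value 0 at [v^T]. *)
Lemma pdmx_unit p (M : 'M[R]_p) : pdmx M -> M \in unitmx.
Proof.
case=> _ posM; rewrite -row_free_unit; apply: inj_row_free => v vM0.
apply/eqP; apply: contraT => v_neq0.
have /posM : v^T != 0 by rewrite trmx_eq0.
by rewrite /quadform trmxK vM0 mul0mx mxE ltxx.
Qed.

Lemma psdmxD p (M N : 'M[R]_p) : psdmx M -> psdmx N -> psdmx (M + N).
Proof.
move=> [/symmxP sM pM] [/symmxP sN pN]; split; last first.
  by move=> x; rewrite quadformD addr_ge0.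
by apply/symmxP; rewrite linearD /= sM sN.
Qed.

Lemma psdmx_congr p q (M : 'M[R]_p) (K : 'M[R]_(p, q)) :
  psdmx M -> psdmx (K^T *m M *m K).
Proof.
move=> [/symmxP sM pM]; split; last by move=> x; rewrite quadform_congr.
by apply/symmxP; rewrite !trmx_mul trmxK sM mulmxA.
Qed.

Lemma psdmxZ p a (M : 'M[R]_p) : 0 <= a -> psdmx M -> psdmx (a *: M).
Proof.
move=> a0 [/symmxP sM pM]; split; last by move=> x; rewrite quadformZ mulr_ge0.
by apply/symmxP; rewrite linearZ /= sM.
Qed.

Lemma psdmx0 p : psdmx (0 : 'M[R]_p).
Proof.
split; first by apply/symmxP; rewrite trmx0.
by move=> x; rewrite /quadform mulmx0 mul0mx mxE.
Qed.

Lemma psdmx_sum p (I : finType) (M : I -> 'M[R]_p) :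
  (forall i, psdmx (M i)) -> psdmx (\sum_i M i).
Proof.
move=> psdM; apply: (big_ind _ (psdmx0 p)) => //; exact: psdmxD.
Qed.

Lemma pdmx_psdmx p (M : 'M[R]_p) : pdmx M -> psdmx M.
Proof. by move=> pdM; split=> [|x]; [case: pdM | exact: pdmx_ge0]. Qed.

Lemma pdmxD_psd p (M N : 'M[R]_p) : pdmx M -> psdmx N -> pdmx (M + N).
Proof.
move=> [/symmxP sM pM] [/symmxP sN pN]; split; last first.
  by move=> x x0; rewrite quadformD ltr_wpDr // pM.
by apply/symmxP; rewrite linearD /= sM sN.
Qed.

Lemma psdmx_cvg p (u : nat -> 'M[R]_p) (M : 'M[R]_p) :
  u s @[s --> \oo] --> M -> (forall s, psdmx (u s)) -> psdmx M.
Proof.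
move=> u_cvg psdu; split.
  have symE s : (u s)^T = u s by apply/symmxP; case: (psdu s).
  apply/symmxP; apply: (cvg_unique (@norm_hausdorff _ _) _ u_cvg).
  by rewrite -(funext symE : (fun s => (u s)^T) = u); exact: cvg_trmx.
move=> x; apply: (cvgr_to_ge (cvg_quadform u_cvg (cvg_cst x))).
by near=> s; case: (psdu s).
Unshelve. all: by end_near.
Qed.

End QuadraticForms.

(** * The Stein equation of a Schur stable matrix *)

Section SteinEquation.
Variables (R : realType) (n : nat) (F : 'M[R]_n).
Hypothesis stabF : schur_stable F.

Lemma schur_stable_orbit_cvg0 (x : 'cV[R]_n) :
  iter t (mulmx F) x @[t --> \oo] --> (0 : 'cV[R]_n).
Proof.
by apply: cvg_mx => i j; rewrite (ord1 j) mxE; exact: schur_stable_iter_cvg0.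
Qed.

(** The hypothesis makes the form of [P] nonincreasing along orbits of [F]. These tend to 0, so the
    initial value is at least the limit 0. *)
Lemma stein_ge0 (P : 'M[R]_n) :
  (forall x, 0 <= quadform (P - F^T *m P *m F) x) ->
  forall x, 0 <= quadform P x.
Proof.
move=> ge0 x.
have le_orbit t : quadform P (iter t (mulmx F) x) <= quadform P x.
  elim: t => //= t; apply: le_trans.
  by rewrite -subr_ge0 -quadform_congr -quadformN -quadformD.
have lim0 : quadform P (iter t (mulmx F) x) @[t --> \oo] --> 0.
  rewrite -(quadform_v0 P).
  apply: cvg_quadform (schur_stable_orbit_cvg0 x); exact: cvg_cst.
apply: (cvgr_to_le lim0).
by near=> t; exact: le_orbit.
Unshelve. all: by end_near.
Qed.

(** The bilinear form of [P] is constant along a pair of orbits and tends to 0, hence vanishes; unit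
    vectors then read off the entries of [P]. *)
Lemma stein_inj (P : 'M[R]_n) : P = F^T *m P *m F -> P = 0.
Proof.
move=> PE.
have orbitE (x y : 'cV[R]_n) t :
    (iter t (mulmx F) x)^T *m P *m iter t (mulmx F) y = x^T *m P *m y.
  elim: t => //= t <-; rewrite [in RHS]PE trmx_mul !mulmxA //.
have bil0 (x y : 'cV[R]_n) : x^T *m P *m y = 0.
  have lim0 : x^T *m P *m y @[_ --> \oo] --> (0 : 'M[R]_1).
    rewrite -(mulmx0 _ (0^T *m P)) -(funext (orbitE x y)).
    apply: cvg_mulmx (schur_stable_orbit_cvg0 y).
    by apply: cvg_mulmx (cvg_cst P); exact: cvg_trmx (schur_stable_orbit_cvg0 x).
  exact: (cvg_unique (@norm_hausdorff _ _) (cvg_cst _) lim0).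
apply/matrixP => i j; rewrite mxE.
have := bil0 (delta_mx i ord0) (delta_mx j ord0).
by rewrite trmx_delta -rowE -colE => /matrixP/(_ ord0 ord0); rewrite !mxE.
Qed.

(** The vectorised Stein operator is a square matrix with trivial kernel, hence invertible. Giving
    its inverse as one matrix [G] yields existence and uniqueness of solutions, and also their
    continuity in [M], since multiplication by [G] is continuous. *)
Lemma stein_inverse : exists G : 'M[R]_(n * n), forall P M : 'M[R]_n,
  P - F^T *m P *m F = M <-> P = vec_mx (mxvec M *m G).
Proof.
pose L : 'M[R]_(n * n) := 1%:M - lin_mulmx F^T *m lin_mulmxr F.
have LE P : mxvec P *m L = mxvec (P - F^T *m P *m F).
  by rewrite mulmxBr mulmx1 mulmxA !mul_vec_lin /= linearB.
have unitL : L \in unitmx.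
  rewrite -row_free_unit; apply: inj_row_free => v.
  rewrite -[v]vec_mxK LE -[RHS](linear0 mxvec) => /(can_inj mxvecK)/eqP.
  by rewrite subr_eq0 => /eqP/stein_inj ->; rewrite linear0.
exists (invmx L) => P M; split=> [<-|->].
  by rewrite -LE mulmxK // mxvecK.
by apply: (can_inj mxvecK); rewrite -LE vec_mxK mulmxKV.
Qed.

Lemma stein_unique (P P' : 'M[R]_n) :
  P - F^T *m P *m F = P' - F^T *m P' *m F -> P = P'.
Proof. by have [G GP] := stein_inverse => /GP ->; apply/esym/GP. Qed.

(** Symmetry comes from uniqueness: [P^T] solves the same equation because the right-hand side is
    symmetric. *)
Lemma stein_psd (P : 'M[R]_n) : psdmx (P - F^T *m P *m F) -> psdmx P.
Proof.
move=> [/symmxP symM /stein_ge0 P_ge0]; split=> //; apply/symmxP/stein_unique.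
by rewrite -[RHS]symM linearB /= !trmx_mul trmxK mulmxA.
Qed.

(** The sum telescopes: the terms before [t] add up to the form of [P] at [x] minus its value at the
    orbit point of index [t], which tends to 0. *)
Lemma stein_series (P : 'M[R]_n) x :
  limn (series (fun t =>
    quadform (P - F^T *m P *m F) (iter t (mulmx F) x))) = quadform P x.
Proof.
apply: cvg_lim => //.
rewrite (_ : series _ = fun t => quadform P x - quadform P (iter t (mulmx F) x)).
  rewrite -[X in _ --> X]subr0 -(quadform_v0 P).
  apply: cvgB; first exact: cvg_cst.
  exact: cvg_quadform (cvg_cst P) (schur_stable_orbit_cvg0 x).
apply/funext => t; pose f k := quadform P (iter k (mulmx F) x).
rewrite /series /= -[RHS]/(f 0%N - f t) -[RHS]opprB -telescope_sumr // -sumrN.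
apply: eq_bigr => k _.
by rewrite quadformD quadformN quadform_congr opprB.
Qed.

End SteinEquation.

(** * Completion of squares *)

Section CompletionOfSquares.
Variables (R : realType) (n m : nat).

(** The condition on [K] turns the linear terms of the matrix quadratic [phi] into
    [- X^T W K - K^T W X], so [phi X] differs from [(X - K)^T W (X - K)] by a term independent of
    [X]. *)
Lemma response_completion (P A : 'M[R]_n) (B : 'M[R]_(n, m)) (S : 'M[R]_m)
    (K L : 'M[R]_(m, n)) :
  let W := S + B^T *m P *m B in
  let phi X := X^T *m S *m X + (A - B *m X)^T *m P *m (A - B *m X) in
  P^T = P -> S^T = S -> B^T *m P *m A = W *m K ->
  phi L = phi K + (L - K)^T *m W *m (L - K).
Proof.
move=> W phi symP symS gainK.
have symW : W^T = W by rewrite linearD /= symS !trmx_mul trmxK symP mulmxA.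
have gainKT : A^T *m P *m B = K^T *m W.
  by rewrite -[in RHS]symW -trmx_mul -gainK !trmx_mul trmxK symP mulmxA.
have phiE X : phi X =
    A^T *m P *m A + X^T *m W *m X - X^T *m W *m K - K^T *m W *m X.
  rewrite -gainKT -(mulmxA X^T W K) -gainK /phi /W.
  rewrite [(A - _)^T]linearB /= trmx_mul.
  rewrite !(mulmxBl, mulmxBr, mulmxDl, mulmxDr, mulNmx, mulmxA).
  (* The noncommutative monomials become opaque matrices; what remains is additive and is checked
     entrywise. *)
  move: (X^T *m S *m X) (A^T *m P *m A) (A^T *m P *m B *m X)
    (X^T *m B^T *m P *m A) (X^T *m B^T *m P *m B *m X).
  by move=> a b c d e; apply/matrixP => i j; rewrite !mxE; ring.
rewrite !phiE [(L - K)^T]linearB /= !(mulmxBl, mulmxBr).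
set a := _ *m A; set b := L^T *m _ *m L; set c := L^T *m _ *m K.
set d := K^T *m _ *m L; set e := K^T *m _ *m K.
by move: a b c d e => a b c d e; apply/matrixP => i j; rewrite !mxE; ring.
Qed.

End CompletionOfSquares.

(** * Costs and best responses *)

Section Responses.
Variables (R : realType) (N n : nat) (m : 'I_N -> nat).
Implicit Types (A : 'M[R]_n) (B : @input_matrices R N n m)
  (K : @profile R N n m) (G : @lqgame R N n m) (i : 'I_N).

(** Under the feedback [u = - K x] the input costs become costs on the state. This is the right-hand
    side of the Stein equation for the cost matrix. *)
Definition state_weight G i K : 'M[R]_n :=
  costQ G i + \sum_j (K j)^T *m costR G i j *m K j.

Lemma closed_loopE A B K i :
  closed_loop A B K = others_loop A B K i - B i *m K i.
Proof. by rewrite /closed_loop (bigD1 i) //= opprD addrCA addrC. Qed.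

Lemma closed_loop_dfwith A B K i Ki :
  closed_loop A B (dfwith K i Ki) = others_loop A B K i - B i *m Ki.
Proof.
rewrite (closed_loopE _ _ _ i) dfwithin /others_loop; congr (_ - _ - _).
by apply: eq_bigr => j ji; rewrite dfwithout // eq_sym.
Qed.

(** A deviation changes only the player's own control term; adding these terms crosswise avoids
    subtraction. *)
Lemma state_weight_dfwith G K i Ki :
  state_weight G i (dfwith K i Ki) + (K i)^T *m costR G i i *m K i =
  state_weight G i K + Ki^T *m costR G i i *m Ki.
Proof.
rewrite /state_weight (bigD1 i) //= [in RHS](bigD1 i) //= dfwithin.
rewrite (eq_bigr (fun j => (K j)^T *m costR G i j *m K j)); last first.
  by move=> j ji; rewrite dfwithout // eq_sym.
rewrite -!addrA; congr (_ + _).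
by rewrite addrCA [RHS]addrCA [in RHS](addrC (_ *m K i)).
Qed.

Lemma stateE A B K x t :
  state A B K x t = iter t (mulmx (closed_loop A B K)) x.
Proof.
elim: t => //= t <-; rewrite /closed_loop mulmxBl mulmx_suml -sumrN.
by congr (_ + _); apply: eq_bigr => j _; rewrite /input mulmxN mulmxA.
Qed.

Lemma stage_costE G i K x : stage_cost G i K x = quadform (state_weight G i K) x.
Proof.
rewrite quadformD quadform_sum; congr (_ + _).
by apply: eq_bigr => j _; rewrite quadform_congr quadform_oppv.
Qed.

Lemma cost_stein G i K P x :
  let F := closed_loop (dynA G) (dynB G) K in
  admissible (dynA G) (dynB G) K ->
  P - F^T *m P *m F = state_weight G i K ->
  cost G i K x = quadform P x.
Proof.
move=> F admK PE; rewrite -(stein_series admK P x) /cost.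
by congr (limn (series _)); apply/funext => t; rewrite stage_costE stateE -PE.
Qed.

(** With the other laws fixed, player [i] faces a linear-quadratic problem with dynamics
    [others_loop]. The gain equation is its first-order condition, and [psdmx W] makes the
    stationary law optimal. *)
Lemma stationary_best_response G K i P :
  let B := dynB G i in
  let W := costR G i i + B^T *m P *m B in
  let F := closed_loop (dynA G) (dynB G) K in
  admissible (dynA G) (dynB G) K ->
  costR G i i \is symmetricmx -> P^T = P -> psdmx W ->
  P - F^T *m P *m F = state_weight G i K ->
  B^T *m P *m others_loop (dynA G) (dynB G) K i = W *m K i ->
  forall x Ki, admissible (dynA G) (dynB G) (dfwith K i Ki) ->
  cost G i K x <= cost G i (dfwith K i Ki) x.
Proof.
move=> B W F admK /symmxP symS symP psdW PE gainK x Ki admKi.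
have [H steinH] := stein_inverse admKi.
pose M' := state_weight G i (dfwith K i Ki).
pose P' := vec_mx (mxvec M' *m H).
have PE' := (steinH P' M').2 erefl.
rewrite (cost_stein x admK PE) (cost_stein x admKi PE').
rewrite -subr_ge0 -quadformN -quadformD.
apply: (stein_ge0 admKi) => y.
set F' := closed_loop _ _ _ in PE' *.
(* A linear combination of the two Stein equations, the change of state weight and the completed
   square. *)
have -> : P' - P - F'^T *m (P' - P) *m F' = (Ki - K i)^T *m W *m (Ki - K i).
  have := response_completion Ki symP symS gainK.
  rewrite -closed_loopE -closed_loop_dfwith -/F -/F' -/W => squares.
  have := state_weight_dfwith G K Ki; rewrite -/M' -PE -PE'.
  move: squares; move: ((Ki - K i)^T *m W *m _) => g.
  rewrite (mulmxBr F'^T P' P) mulmxBl.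
  move: (F^T *m P *m F) (F'^T *m P *m F').
  move: (F'^T *m P' *m F') (Ki^T *m _ *m Ki) ((K i)^T *m _ *m K i).
  move=> a b c d e sq E.
  apply/matrixP => k l; move: sq E => /matrixP/(_ k l) sq /matrixP/(_ k l).
  by move: sq; rewrite !mxE; lra.
by case: (psdmx_congr (Ki - K i) psdW).
Qed.

End Responses.

(** * Stationarity of the limit of the iteration *)

Section InverseIteration.
Variables (R : realType) (n m : nat).

(* For every x and y, [y^T W y + 2 y^T (W delta) x + x^T delta^T W delta x] is a
   value of the form W, hence nonnegative; its last term vanishes in the limit,
   and a nonnegative affine function of x has no linear part. *)
Lemma gain_stationary_limit (A : 'M[R]_n) (B : 'M[R]_(n, m)) (S : 'M[R]_m)
    (K : 'M[R]_(m, n)) (a : R) (Q P : nat -> 'M[R]_n) (Qinf Pinf : 'M[R]_n) :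
  let W X := S + B^T *m X *m B in
  let gap X := invmx (W X) *m B^T *m X *m A - K in
  0 < a -> (forall s, pdmx (W (P s))) ->
  (forall s, Q s.+1 = Q s + a *: ((gap (P s))^T *m W (P s) *m gap (P s))) ->
  Q s @[s --> \oo] --> Qinf -> P s @[s --> \oo] --> Pinf ->
  B^T *m Pinf *m A = W Pinf *m K.
Proof.
move=> W gap a_gt0 pdW QS cvgQ cvgP.
(* The residual [Y] is the gap multiplied by its weight. It contains no inverse, so it passes to the
   limit by continuity of products alone. *)
pose Y X := B^T *m X *m A - W X *m K.
have gapE s : W (P s) *m gap (P s) = Y (P s).
  by rewrite mulmxBr !mulmxA mulmxV ?mul1mx //; exact: pdmx_unit.
have cvgW : W (P s) @[s --> \oo] --> W Pinf.
  apply: cvgD; first exact: cvg_cst.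
  by apply: cvg_mulmx (cvg_cst _); apply: cvg_mulmx cvgP; exact: cvg_cst.
have cvgY : Y (P s) @[s --> \oo] --> Y Pinf.
  apply: cvgB; last by apply: cvg_mulmx cvgW _; exact: cvg_cst.
  by apply: cvg_mulmx (cvg_cst _); apply: cvg_mulmx cvgP; exact: cvg_cst.
have affine_ge0 (x : 'cV[R]_n) (y : 'cV[R]_m) :
    0 <= quadform (W Pinf) y + 2 * (y^T *m Y Pinf *m x) ord0 ord0.
  (* The added zero is the limit of [a^-1 * quadform (Q s.+1 - Q s) x], which is the form of
     [W (P s)] at [gap (P s) *m x]. With it, the expression at step [s] is that form at
     [y + gap (P s) *m x]. *)
  rewrite -[leRHS]addr0 -[X in _ + X](mulr0 a^-1).
  have cvg_incr : quadform (Q s.+1 - Q s) x @[s --> \oo] --> 0.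
    rewrite -(_ : quadform (Qinf - Qinf) x = 0); last first.
      by rewrite quadformD quadformN subrr.
    apply: cvg_quadform (cvg_cst x).
    by apply: cvgB => //; rewrite cvg_shiftS.
  apply: (@cvgr_to_ge _ \oo _ _ (fun s => quadform (W (P s)) y
      + 2 * (y^T *m Y (P s) *m x) ord0 ord0 + a^-1 * quadform (Q s.+1 - Q s) x)).
    apply: cvgD; last by apply: cvgM cvg_incr; exact: cvg_cst.
    apply: cvgD; first exact: cvg_quadform cvgW (cvg_cst y).
    apply: cvgM; first exact: cvg_cst.
    apply: cvg_mx_entry; apply: cvg_mulmx (cvg_cst x).
    by apply: cvg_mulmx cvgY; exact: cvg_cst.
  near=> s.
  rewrite QS [Q s + _]addrC addrK quadformZ
    mulKf ?gt_eqF // quadform_congr -gapE.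
  rewrite !mulmxA -(mulmxA _ (gap _)) -quadform_addv;
    last by apply/symmxP; case: (pdW s).
  exact: pdmx_ge0.
apply/eqP; rewrite -subr_eq0 -/(Y Pinf); apply/eqP/matrixP => k l.
have := fun c => affine_ge0 (c *: delta_mx l ord0) (delta_mx k ord0).
set q := quadform _ _; have -> : (0 : 'M[R]_(m, n)) k l = 0 by rewrite mxE.
have entryE (Z : 'M[R]_(m, n)) c :
    ((delta_mx k ord0 : 'cV[R]_m)^T *m Z *m (c *: (delta_mx l ord0 : 'cV[R]_n)))
      ord0 ord0 = c * Z k l.
  by rewrite -scalemxAr trmx_delta -rowE -colE !mxE.
have {entryE} := entryE (Y Pinf).
move: (Y Pinf k l) => b bE ge0; apply/eqP; apply: contraT => b_neq0.
(* At this multiple of the unit vector the affine function takes the value [q - (q + 1) = -1]. *)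
have := ge0 (- (q + 1) / (2 * b)); rewrite bE.
have -> : 2 * (- (q + 1) / (2 * b) * b) = - (q + 1) by field.
by lra.
Unshelve. all: by end_near.
Qed.

End InverseIteration.

(** * Semidefiniteness along the iteration, and the limit game *)

Lemma stein_eqE (R : realType) (N n : nat) (m : 'I_N -> nat)
    (A : 'M[R]_n) (B : @input_matrices R N n m) (K : @profile R N n m)
    (Rc : 'I_N -> forall j : 'I_N, 'M[R]_(m j)) (i : 'I_N) (Q P : 'M[R]_n) :
  let F := closed_loop A B K in
  stein_eq A B K Rc i Q P ->
  P - F^T *m P *m F = Q + \sum_j (K j)^T *m Rc i j *m K j.
Proof.
rewrite /stein_eq -closed_loopE => /eqP.
by rewrite -addrA addr_eq0 opprD opprK => /eqP ->.
Qed.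

(** By induction: a semidefinite [Q s i] gives the Stein equation a semidefinite right-hand side,
    hence a semidefinite [P s.+1 i]. The increment of [Q] is then a positive multiple of a
    congruence of a semidefinite weight. *)
Lemma iteration_psd (R : realType) (N n : nat) (m : 'I_N -> nat)
    (A : 'M[R]_n) (B : @input_matrices R N n m) (Ko : @profile R N n m)
    (Rc : 'I_N -> forall j : 'I_N, 'M[R]_(m j)) (alpha : 'I_N -> R)
    (Q0 : 'I_N -> 'M[R]_n) (P Q : nat -> 'I_N -> 'M[R]_n) (i : 'I_N) :
  schur_stable (closed_loop A B Ko) ->
  (forall j, psdmx (Rc i j)) -> pdmx (Rc i i) -> psdmx (Q0 i) -> 0 < alpha i ->
  model_based_iteration A B Ko Rc alpha Q0 P Q ->
  forall s, psdmx (Q s i) /\ psdmx (P s.+1 i).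
Proof.
move=> stabF psdR pdR psdQ0 a_gt0 [Q0E steinP QS].
have psdP s : psdmx (Q s i) -> psdmx (P s.+1 i).
  move=> psdQ; apply: (stein_psd stabF).
  rewrite (stein_eqE (steinP s i)).
  by apply: psdmxD => //; apply: psdmx_sum => j; exact: psdmx_congr.
suff psdQ s : psdmx (Q s i) by move=> s; split=> //; exact: psdP.
elim: s => [|s IHs]; first by rewrite Q0E.
rewrite QS; apply: psdmxD => //; apply: psdmxZ; first exact: ltW.
apply/psdmx_congr/psdmxD; first exact: pdmx_psdmx.
exact/psdmx_congr/psdP.
Qed.

Theorem theorem2 (R : realType) (N n : nat) (m : 'I_N -> nat)
    (A : 'M[R]_n) (B : forall j : 'I_N, 'M[R]_(n, m j))
    (* the observed game, its cost parameters and its equilibrium *)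
    (Ko : forall j : 'I_N, 'M[R]_(m j, n))
    (Qo : 'I_N -> 'M[R]_n) (Ro : 'I_N -> forall j : 'I_N, 'M[R]_(m j))
    (hobs : is_lqgame (LQGame A B Qo Ro))
    (hQo : forall i, psdmx (Qo i))
    (hRo : forall i j, psdmx (Ro i j))
    (hKo : is_nash (LQGame A B Qo Ro) Ko)
    (* the data of the iteration *)
    (Rc : 'I_N -> forall j : 'I_N, 'M[R]_(m j)) (Q0 : 'I_N -> 'M[R]_n)
    (alpha : 'I_N -> R)
    (hRii : forall i, pdmx (Rc i i))
    (hRij : forall i j, j != i -> psdmx (Rc i j))
    (hQ0 : forall i, psdmx (Q0 i))
    (halpha : forall i, 0 < alpha i <= 1)
    (* the iterates and their limits *)
    (P Q : nat -> 'I_N -> 'M[R]_n)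
    (hiter : model_based_iteration A B Ko Rc alpha Q0 P Q)
    (Qinf : 'I_N -> 'M[R]_n)
    (hlim : forall i, Q s i @[s --> \oo] --> Qinf i) :
  is_lqgame (LQGame A B Qinf Rc) /\ is_nash (LQGame A B Qinf Rc) Ko.
Proof.
have [admK _] := hKo; rewrite /= in admK.
have [stab _ _ _] := hobs.
have psdR i j : psdmx (Rc i j).
  by have [->|ji] := eqVneq j i; [exact/pdmx_psdmx/hRii | exact: hRij].
have a_gt0 i : 0 < alpha i by case/andP: (halpha i).
have psdPQ i := iteration_psd admK (psdR i) (hRii i) (hQ0 i) (a_gt0 i) hiter.
have psdQinf i : psdmx (Qinf i).
  by apply: (psdmx_cvg (@hlim i)) => s; case: (psdPQ i s).
have [_ steinP QS] := hiter.
split; first by split=> // [i|i j]; [case: (psdQinf i) | case: (psdR i j)].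
split=> // i x0 Ki.
pose G := LQGame A B Qinf Rc.
have [H steinH] := stein_inverse admK.
pose Pinf := vec_mx (mxvec (state_weight G i Ko) *m H).
(* Convergence is assumed for [Q] only; that of [P] follows because the inverse Stein operator is
   one fixed matrix [H]. The sequence is shifted because [P 0] is arbitrary. *)
have cvgP : P s.+1 i @[s --> \oo] --> Pinf.
  have PE s : P s.+1 i =
      vec_mx (mxvec (Q s i + \sum_j (Ko j)^T *m Rc i j *m Ko j) *m H).
    exact/steinH/stein_eqE/steinP.
  rewrite (funext PE); apply: cvg_vec_mx; apply: cvg_mulmx (cvg_cst H).
  by apply: cvg_mxvec; apply: cvgD (cvg_cst _); exact: hlim.
have psdPinf : psdmx Pinf.
  by apply: (psdmx_cvg cvgP) => s; case: (psdPQ i s).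
have gainK : (B i)^T *m Pinf *m others_loop A B Ko i =
    (Rc i i + (B i)^T *m Pinf *m B i) *m Ko i.
  apply: (gain_stationary_limit (a_gt0 i) _ (fun s => QS s i) (@hlim i) cvgP).
  move=> s; apply: pdmxD_psd; first exact: hRii.
  by apply: psdmx_congr; case: (psdPQ i s).
have symR : Rc i i \is symmetricmx by case: (psdR i i).
have symP : Pinf^T = Pinf by apply/symmxP; case: psdPinf.
have psdW : psdmx (Rc i i + (B i)^T *m Pinf *m B i).
  by apply: psdmxD => //; exact: psdmx_congr.
have steinPinf := (steinH Pinf (state_weight G i Ko)).2 erefl.
have best := @stationary_best_response R N n m G Ko i Pinf admK symR symP psdW
  steinPinf gainK x0 Ki.
exact: best.
Qed.
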